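(* For the admission control to minimize rejections problem described in the context, in the unweighted case where every request has cost $1$, there is a randomized preemptive online algorithm that is $O(\log m\log c)$-competitive, i.e. the expected number of requests it rejects is at most $O(\log m\log c)\cdot C_{OPT}$.
   Context: Admission control to minimize rejections: a directed graph $G=(V,E)$ with $|E|=m$ is given, each edge $e$ having an integer capacity $c_e>0$; let $c=\max_{e\in E}c_e$. Requests $r_1,r_2,\ldots$ arrive one at a time; each request is a simple path in $G$ (here each has cost $1$). A feasible solution is a set of accepted requests such that for every edge $e$ the number of accepted requests whose paths contain $e$ is at most $c_e$; its cost is the number of rejected requests. $C_{OPT}$ is the minimum cost of a feasible solution for the whole sequence. The online algorithm must decide upon arrival of each request whether to accept or reject it, keeping the set of currently accepted requests feasible at all times; it may preempt (reject a previously accepted request) but may never accept a request once rejected. An algorithm is $\beta$-competitive if the expected cost of its rejections is at most $\beta C_{OPT}$. *)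

(* Defs.v *)
From HB Require Import structures.
From mathcomp Require Import all_boot all_order all_algebra.
From mathcomp Require Import all_classical all_reals all_analysis.

Set Implicit Arguments.
Unset Strict Implicit.
Unset Printing Implicit Defensive.

Import Order.TTheory GRing.Theory Num.Theory.

Local Open Scope nat_scope.

Record network := Network {
  vertex : finType;
  edges : {set vertex * vertex};
  capacity : vertex * vertex -> nat;
  capacity_gt0 : forall e, e \in edges -> 0 < capacity e }.

Definition max_capacity (G : network) : nat :=
  \max_(e in edges G) capacity e.

Definition simple_path (G : network) (p : seq (vertex G)) : bool :=
  if p is x :: q then path (fun u v => (u, v) \in edges G) x q && uniq p
  else false.

Definition request (G : network) := {p : seq (vertex G) | simple_path p}.

Definition uses (G : network) (r : request G) (e : vertex G * vertex G) : bool :=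
  e \in zip (val r) (behead (val r)).

(* A solution for the request sequence s is the set of (positions of) accepted
   requests; equal paths at different positions are different requests. *)
Definition solution (G : network) (s : seq (request G)) := {set 'I_(size s)}.

Definition feasible (G : network) (s : seq (request G)) (A : solution s) : bool :=
  [forall e in edges G,
     #|[set i in A | uses (tnth (in_tuple s) i) e]| <= capacity e].

Definition cost (G : network) (s : seq (request G)) (A : solution s) : nat :=
  #|~: A|.

(* The empty solution (reject everything) is always feasible, so the arg min is genuine. *)
Definition opt (G : network) (s : seq (request G)) : nat :=
  cost [arg min_(A < (finset.set0 : solution s) | feasible A) cost A].

(* accepted s is the set of requests that are accepted once exactly the
   requests in s have arrived; the algorithm is online because this set is a
   function of s alone.  By no_reaccept, requests may be preempted but never
   accepted after having been rejected. *)
Record online_algorithm (G : network) := OnlineAlgorithm {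
  accepted : forall s : seq (request G), solution s;
  accepted_feasible : forall s, feasible (accepted s);
  no_reaccept : forall s r (i : 'I_(size s)) (j : 'I_(size (rcons s r))),
    i = j :> nat -> j \in accepted (rcons s r) -> i \in accepted s }.

Local Open Scope ring_scope.

(* A random choice among deterministic online algorithms; the last field says
   that every decision is an event. *)
Record randomized_algorithm (R : realType) (G : network) := RandomizedAlgorithm {
  sample_display : measure_display;
  sample : measurableType sample_display;
  sample_prob : probability sample R;
  run : sample -> online_algorithm G;
  measurable_run : forall (s : seq (request G)) (i : 'I_(size s)),
    measurable [set w : sample | i \in accepted (run w) s]%classic }.

Arguments run {R G} r w.

Definition expected_cost (R : realType) (G : network)
    (A : randomized_algorithm R G) (s : seq (request G)) : \bar R :=
  ('E_(sample_prob A)[fun w => (cost (accepted (run A w) s))%:R])%E.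

Definition competitive (R : realType) (G : network)
    (A : randomized_algorithm R G) (beta : R) : Prop :=
  forall s : seq (request G), (expected_cost A s <= (beta * (opt s)%:R)%:E)%E.

(* Main.v *)
(* Write c for the largest capacity and m for the number of edges.  A fractional
   solution gives request i a rejected fraction w i / c.  If x more requests
   alive on e (those with w i < c) must be rejected, while their weights sum to
   less than c x, all of them are multiplied by 1 + 1/x, after raising the zero
   ones to 1.  Each such step costs O(1) fractional rejections, and it at least
   doubles the product of max (w i) 1 over the requests rejected by any fixed
   feasible solution, because x of them get a factor 1 + 1/x.  That product is
   at most (2c)^OPT, so there are O(OPT log c) steps.

   For the rounding, request i draws a uniform digit in {0, ..., c-1} and is
   rejected once the digit is below a * w i, with a = 2 + 2 ln (1+m); a new
   request that still does not fit is rejected on arrival.  By a Chernoff bound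
   an overfull edge e forces such a rejection with probability at most
   1 / (1+m), and only while more than c_e requests through e have arrived,
   that is for at most OPT of its requests; over all edges this adds at most
   OPT.  The digits are those of a uniform real number in base c. *)

Require Import Defs.
From HB Require Import structures.
From mathcomp Require Import all_boot all_order all_algebra.
From mathcomp Require Import all_classical all_reals all_analysis.
From mathcomp Require Import measurable_realfun ring lra zify.

Set Implicit Arguments.
Unset Strict Implicit.
Unset Printing Implicit Defensive.

Import Order.TTheory GRing.Theory Num.Theory.

Local Open Scope ring_scope.

(** * Fractional solution *)

Lemma count_index_iotaS (a : pred nat) n :
  count a (index_iota 0 n.+1) = (count a (index_iota 0 n) + a n)%N.
Proof. by rewrite /index_iota !subn0 -addn1 iotaD count_cat /= add0n addn0. Qed.

Lemma natr_count (R : pzSemiRingType) (I : Type) (P : pred I) (r : seq I) :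
  (count P r)%:R = \sum_(i <- r) (P i)%:R :> R.
Proof.
by rewrite -sum1_count big_mkcond natr_sum; apply: eq_bigr => i _; case: (P i).
Qed.

Lemma count_split (a b : pred nat) (s : seq nat) :
  count a s = (count (fun i => a i && b i) s + count (fun i => a i && ~~ b i) s)%N.
Proof. by elim: s => //= i s ->; case: (a i); case: (b i) => /=; lia. Qed.

Section FractionalAlgorithm.

Variables (R : realType) (T : finType) (E : {set T}) (cap : T -> nat) (c : nat).

(* u i e: request i uses edge e.  Weights are c times the rejected fractions. *)
Definition alive (u : nat -> T -> bool) (g : nat -> R) (e : T) : pred nat :=
  [pred i | u i e && (g i < c%:R)].

Definition excess u n g e : nat :=
  (count (alive u g e) (index_iota 0 n) - cap e)%N.

Definition violated u n g e : bool :=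
  \sum_(0 <= i < n | alive u g e i) g i < (c * excess u n g e)%:R.

Definition augment u n (g : nat -> R) : nat -> R :=
  if [pick e in E | violated u n g e] is Some e then
    fun i => if (i < n)%N && alive u g e i
             then Num.max (g i) 1 * (1 + (excess u n g e)%:R^-1) else g i
  else g.

(* By invariant_lt_rounds below, enough augmentations to leave no violated edge. *)
Definition rounds (n : nat) : nat := (2 * c * n).+1.

Fixpoint weights u (n : nat) : nat -> R :=
  if n is k.+1 then iter (rounds n) (augment u n) (weights u k) else fun=> 0.

Lemma augment_ext u v n : (forall i, (i < n)%N -> u i = v i) ->
  augment u n = augment v n.
Proof.
move=> uv.
have al g e i : (i < n)%N -> alive u g e i = alive v g e i.
  by move=> /uv uvi; rewrite /alive /= uvi.
have ex g e : excess u n g e = excess v n g e.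
  rewrite /excess; congr (_ - _)%N; apply: eq_in_count => i.
  by rewrite mem_index_iota /= => /al.
apply/funext => g; rewrite /augment.
rewrite (@eq_pick _ _ [pred e in E | violated v n g e]); last first.
  move=> e /=; rewrite /violated ex; congr (_ && (_ < _)).
  by rewrite big_nat_cond [RHS]big_nat_cond; apply: eq_bigl => i; case: ltnP => //= /al.
case: pickP => // e _; apply/funext => i; rewrite ex.
by case: ltnP => //= /al /= ->.
Qed.

(** This is what makes the algorithm online: augmentations look only at requests that have
    arrived. *)
Lemma weights_ext u v n : (forall i, (i < n)%N -> u i = v i) ->
  weights u n = weights v n.
Proof.
elim: n => [//|n IH] uv; rewrite [LHS]/= [RHS]/= IH; last first.
  by move=> i /leqW; apply: uv.
by rewrite (augment_ext uv).
Qed.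

Variable u : nat -> T -> bool.

Definition respects n (B : pred nat) : Prop := forall e, e \in E ->
  (count (fun i => B i && u i e) (index_iota 0 n) <= cap e)%N.

(** [k] counts the augmentations made at a violated edge. [inv_zeros] limits how many zero weights
    one step can raise, with one unit of slack for the latest arrival; [B] in [inv_potential] ranges
    over the offline solutions. *)
Record invariant n (g : nat -> R) k : Prop := Invariant {
  inv_range : forall i, g i = 0 \/ 1 <= g i <= (2 * c)%:R;
  inv_support : forall i, (n <= i)%N -> g i = 0;
  inv_zeros : forall e, e \in E ->
    (count (fun i => u i e && (g i == 0%R)) (index_iota 0 n) <= (cap e).+1)%N;
  inv_sum : \sum_(0 <= i < n) g i <= (5 * c * k)%:R;
  inv_potential : forall B, respects n B ->
    2 ^+ k <= \prod_(0 <= i < n | ~~ B i) Num.max (g i) 1 }.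

Hypothesis c_gt0 : (0 < c)%N.
Hypothesis cap_le : forall e, e \in E -> (cap e <= c)%N.

Lemma range_ge0 (x : R) : x = 0 \/ 1 <= x <= (2 * c)%:R -> 0 <= x.
Proof. by case=> [->//|/andP[x1 _]]; apply: le_trans x1. Qed.

Lemma pow_one_plus_inv (x : nat) : (0 < x)%N -> 2 <= (1 + x%:R^-1) ^+ x :> R.
Proof.
move=> x0; have bern (y : R) : 0 <= y -> forall m, 1 + m%:R * y <= (1 + y) ^+ m.
  move=> y0; elim=> [|m IH]; first by rewrite expr0 mul0r addr0.
  rewrite exprS -natr1; have m0 : 0 <= m%:R :> R by [].
  have : 0 <= m%:R * y * y by rewrite !mulr_ge0.
  nra.
have := bern x%:R^-1 _ x; rewrite invr_ge0 ler0n => /(_ isT).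
by rewrite mulfV // pnatr_eq0 -lt0n.
Qed.

Lemma raise_ge (x : R) (k : nat) :
  0 <= x -> x <= Num.max x 1 * (1 + k%:R^-1).
Proof.
move=> x0; have m1 : x <= Num.max x 1 by rewrite le_max lexx.
by rewrite (le_trans m1) // ler_peMr ?(le_trans x0) // lerDl invr_ge0.
Qed.

Lemma augment_ge n g : (forall i, 0 <= g i) -> forall i, g i <= augment u n g i.
Proof.
move=> g0 i; rewrite /augment; case: pickP => // e _.
by case: ifP => // _; apply: raise_ge.
Qed.

Lemma augment_invariant n g k : invariant n g k ->
  [exists e in E, violated u n g e] -> invariant n (augment u n g) k.+1.
Proof.
move=> [rg sg zg hg pg] /existsP[e0 /andP[e0E ve0]].
rewrite /augment; case: pickP => [e /= /andP[eE ve]|/(_ e0) /=]; last first.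
  by rewrite e0E ve0.
set x := excess u n g e; set r := 1 + x%:R^-1.
have g_ge0 i : 0 <= g i by apply: range_ge0.
have x_gt0 : (0 < x)%N.
  rewrite lt0n; apply/eqP => x0; move: ve; rewrite /violated -/x x0 muln0.
  by rewrite ltNge sumr_ge0.
have xR : 0 < x%:R :> R by rewrite ltr0n.
have r_gt1 : 1 < r by rewrite /r ltrDl invr_gt0.
have r_le2 : r <= 2.
  by rewrite /r -[2]/(1 + 1) lerD2l invf_le1 // ler1n.
have c1 : 1 <= c%:R :> R by rewrite ler1n.
set g' := fun i => _.
have g'P i : (i < n)%N -> alive u g e i -> g' i = Num.max (g i) 1 * r.
  by rewrite /g' => -> ->.
have g'ge i : g i <= g' i.
  by rewrite /g'; case: ifP => // _; apply: raise_ge.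
have g'z i : g' i = 0 -> g i = 0.
  by move=> gi; apply/eqP; rewrite eq_le g_ge0 andbT -gi g'ge.
split.
- move=> i; rewrite /g'; case: ifP => [/andP[_ /andP[_ /= gc]]|_]; last exact: rg.
  right; have m1 : 1 <= Num.max (g i) 1 by rewrite le_max lexx orbT.
  have m2 : Num.max (g i) 1 <= c%:R by rewrite ge_max (ltW gc).
  by rewrite natrM; apply/andP; split; nra.
- by move=> i ni; rewrite /g' ltnNge ni /= sg.
- move=> e1 e1E; apply: leq_trans (zg e1 e1E); apply: sub_count => i /=.
  by case: (u i e1) => //= /eqP/g'z ->.
- have -> : \sum_(0 <= i < n) g' i =
    \sum_(0 <= i < n) g i + \sum_(0 <= i < n | alive u g e i) (g' i - g i).
    rewrite [X in _ + X]big_mkcond -big_split /=; apply: eq_big_nat => i /andP[_ ni].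
    by rewrite /g' ni /=; case: ifP => _; rewrite ?addr0 // addrC subrK.
  (* A positive weight grows by at most its [x^-1] fraction; a zero weight jumps to [r], which is at
     most 2. *)
  have inc i : (i < n)%N -> alive u g e i ->
      g' i - g i <= x%:R^-1 * g i + 2 * (u i e && (g i == 0))%:R.
    move=> ni ai; rewrite g'P //; have [ui _] := andP ai; rewrite ui /=.
    have [gi|/andP[gi _]] := rg i.
      by rewrite gi eqxx max_r //= mulr1; nra.
    rewrite max_l // gt_eqF ?(lt_le_trans ltr01) //= mulr0 addr0 /r; nra.
  have : \sum_(0 <= i < n | alive u g e i) (g' i - g i) <=
     x%:R^-1 * \sum_(0 <= i < n | alive u g e i) g i
     + 2 * (count (fun i => u i e && (g i == 0%R)) (index_iota 0 n))%:R.
    rewrite -sum1_count natr_sum !mulr_sumr [X in _ <= _ + X]big_mkcond /=.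
    apply: (@le_trans _ _ (\sum_(0 <= i < n | alive u g e i)
       (x%:R^-1 * g i + 2 * (u i e && (g i == 0))%:R))).
      rewrite big_nat_cond [leRHS]big_nat_cond; apply: ler_sum => i.
      by case/andP=> /andP[_ ni]; apply: inc.
    rewrite big_split /= lerD2l big_mkcond; apply: ler_sum => i _.
    by case: (u i e && _); case: (alive u g e i); rewrite /= ?mulr0 ?mulr1.
  have := zg e eE; rewrite -(ler_nat R); set z := (count _ _)%:R.
  move: (ve); rewrite /violated -/x natrM; set S := \sum_(_ <= _ < _ | _) g _ => Sx.
  have xS : x%:R^-1 * S <= c%:R by rewrite mulrC ler_pdivrMr // ltW.
  (* One step adds at most [c] by scaling and [2 * (cap e + 1)] through the zeros, together at most
     [5 * c]. *)
  move: hg; rewrite !natrM -[k.+1%:R]natr1 -[(cap e).+1%:R]natr1 mulrDr mulr1.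
  have : (cap e)%:R <= c%:R :> R by rewrite ler_nat cap_le.
  by set D := 5 * _ * _; lra.
- move=> B rB; have := pg B rB.
  set P := \prod_(_ <= _ < _ | _) _ => Pk.
  have k2 : 0 < 2 ^+ k :> R by rewrite exprn_gt0.
  (* [B] keeps at most [cap e] requests on [e], so at least [x] alive ones lie outside [B] and gain
     the factor [r]. *)
  pose w := count (fun i => alive u g e i && ~~ B i) (index_iota 0 n).
  have wx : (x <= w)%N.
    rewrite /x /excess leq_subLR (count_split _ B) leq_add2r.
    apply: leq_trans (rB e eE); apply: sub_count => i /=.
    by case: (B i); rewrite ?andbF //= andbT => /andP[].
  have rw : r ^+ w = \prod_(0 <= i < n | ~~ B i) (if alive u g e i then r else 1).
    rewrite -big_mkcondr big_const_seq iter_mulr_1.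
    by congr (_ ^+ _); apply: eq_count => i; rewrite /= andbC.
  apply: (@le_trans _ _ (P * r ^+ w)).
    have : 2 <= r ^+ w by apply: le_trans (pow_one_plus_inv x_gt0) _; rewrite ler_weXn2l // ltW.
    by rewrite exprS; nra.
  rewrite rw /P -big_split /= big_nat_cond [leRHS]big_nat_cond.
  apply: ler_prod => i /andP[/andP[_ ni] _].
  have m1 : 1 <= Num.max (g i) 1 by rewrite le_max lexx orbT.
  apply/andP; split; first by case: ifP => _; nra.
  case: ifP => [/(g'P i ni)->|_]; first by rewrite le_max lexx.
  by rewrite mulr1 ge_max !le_max g'ge lexx orbT.
Qed.

Lemma augment_id n g :
  ~~ [exists e in E, violated u n g e] -> augment u n g = g.
Proof.
move=> /existsPn nv; rewrite /augment; case: pickP => // e ve.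
by have /negP := nv e; case.
Qed.

(** With [B] empty, the potential gives [2 ^ k <= (2 * c) ^ n], and [2 * c < 2 ^ (2 * c)]. *)
Lemma invariant_lt_rounds n g k : invariant n g k -> (k < rounds n)%N.
Proof.
move=> [rg _ _ _ /(_ pred0) pg].
have {}pg : 2 ^+ k <= (2 * c)%:R ^+ n :> R.
  apply: le_trans (pg _) _; first by move=> e _; rewrite count_pred0.
  rewrite -[X in _ ^+ X]subn0 -prodr_const_nat; apply: ler_prod => i _.
  have c1 : 1 <= (2 * c)%:R :> R by rewrite ler1n muln_gt0.
  rewrite le_max ler01 orbT ge_max c1 andbT /=.
  by case: (rg i) => [->|/andP[]] //; apply: le_trans c1.
move: pg; rewrite -natrX -natrX ler_nat /rounds => pg.
rewrite -(@ltn_exp2l 2) //; apply: leq_ltn_trans pg _.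
rewrite expnS expnM; apply: (@leq_ltn_trans ((2 ^ (2 * c)) ^ n)).
  by case: (posnP n) => [-> //|n0]; rewrite leq_exp2r // ltnW // ltn_expl.
by rewrite ltn_Pmull // expn_gt0 expn_gt0.
Qed.

Lemma iter_augment_invariant n g k j : invariant n g k -> exists k',
  invariant n (iter j (augment u n) g) k' /\
  (~~ [exists e in E, violated u n (iter j (augment u n) g) e] \/ (k + j <= k')%N).
Proof.
move=> gk; elim: j => [|j [k' [gk' H]]]; first by exists k; rewrite addn0; split=> //; right.
set h := iter j _ _ in gk' H *; rewrite iterS -/h.
have [v|nv] := boolP [exists e in E, violated u n h e].
  exists k'.+1; split; first exact: augment_invariant.
  by right; case: H => [/negP|]; [case | rewrite addnS ltnS].
by exists k'; rewrite augment_id //; split=> //; left.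
Qed.

(** Discarding an alive request outside [b] lowers the count by one and the weight sum by less than
    [c], so the inequality passes from all alive requests to [b]. *)
Lemma unviolated_coverage n g e (b : pred nat) : (forall i, 0 <= g i) ->
  ~~ violated u n g e -> (forall i, b i -> alive u g e i) ->
  c%:R * ((count b (index_iota 0 n))%:R - (cap e)%:R) <=
    \sum_(0 <= i < n | b i) g i.
Proof.
move=> g0; rewrite /violated -leNgt => nv ba; set s := index_iota 0 n in nv *.
have -> : \sum_(i <- s | b i) g i =
    \sum_(i <- s | alive u g e i) g i - \sum_(i <- s | alive u g e i && ~~ b i) g i.
  rewrite [X in _ = X - _](bigID b) /= addrK; apply: eq_bigl => i.
  by case: (boolP (b i)) => [/ba /= ->|]; rewrite ?andbF.
have h1 : \sum_(i <- s | alive u g e i && ~~ b i) g i <=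
    c%:R * (count (fun i => alive u g e i && ~~ b i) s)%:R.
  rewrite -sum1_count natr_sum mulr_sumr; apply: ler_sum => i.
  by rewrite mulr1 => /andP[/andP[_ /ltW]].
have h2 : c%:R * ((count (alive u g e) s)%:R - (cap e)%:R) <= (c * excess u n g e)%:R :> R.
  by rewrite natrM ler_wpM2l // lerBlDr -natrD ler_nat addnC -leq_subLR.
have h3 : (count (alive u g e) s)%:R =
    (count b s)%:R + (count (fun i => alive u g e i && ~~ b i) s)%:R :> R.
  rewrite (count_split _ b) natrD; congr (_%:R + _); apply: eq_count => i.
  by case: (boolP (b i)) => [/ba /= ->|]; rewrite ?andbF.
by move: h2; rewrite h3; nra.
Qed.

(** Coverage applied to the zero weights on [e] leaves at most [cap e] of them; the new arrival adds
    at most one. *)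
Lemma invariantS n g k : invariant n g k ->
  ~~ [exists e in E, violated u n g e] -> invariant n.+1 g k.
Proof.
move=> [rg sg zg hg pg] /existsPn nv; have gn : g n = 0 by apply: sg.
split=> //.
- by move=> i /ltnW; apply: sg.
- move=> e eE; rewrite count_index_iotaS gn eqxx andbT.
  suff : (count (fun i => u i e && (g i == 0%R)) (index_iota 0 n) <= cap e)%N.
    by case: (u n e); lia.
  have /unviolated_coverage cov : ~~ violated u n g e.
    by apply/negP => ve; have /negP := nv e; rewrite eE.
  rewrite -(ler_nat R) -subr_le0 -(@pmulr_rle0 _ c%:R) ?ltr0n //.
  apply: le_trans (cov _ _ _) _.
  + by move=> i; apply: range_ge0.
  + by move=> i /= /andP[ui /eqP gi]; rewrite /alive /= ui gi ltr0n.
  + by rewrite big1 // => i /andP[_ /eqP].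
- by rewrite big_nat_recr //= gn addr0.
- move=> B rB; rewrite big_mkcond big_nat_recr //= -big_mkcond gn max_r //.
  rewrite if_same mulr1; apply: pg => e eE; apply: leq_trans (rB e eE).
  by rewrite count_index_iotaS leq_addr.
Qed.

(** If violations outlasted all iterations, [k] would reach [rounds n], against
    [invariant_lt_rounds]. *)
Lemma weights_invariant n :
  (exists k, invariant n (weights u n) k) /\
  ~~ [exists e in E, violated u n (weights u n) e].
Proof.
elim: n => [|n [[k IH] nv]].
  split; last by apply/existsPn => e; rewrite /violated big_geq // /excess sub0n muln0 ltxx andbF.
  exists 0%N; split; rewrite ?big_geq ?muln0 //; first by left.
  by move=> B _; rewrite big_geq.
have [k' [I' H]] := iter_augment_invariant (rounds n.+1) (invariantS IH nv).
split; first by exists k'.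
case: H => // H; have := invariant_lt_rounds I'.
by rewrite ltnNge (leq_trans _ H) // leq_addl.
Qed.

Lemma weights_range n i : weights u n i = 0 \/ 1 <= weights u n i <= (2 * c)%:R.
Proof. by have [[k [rg _ _ _ _]] _] := weights_invariant n. Qed.

Lemma weights_ge0 n i : 0 <= weights u n i.
Proof. exact: range_ge0 (weights_range n i). Qed.

Lemma weights_leS n i : weights u n i <= weights u n.+1 i.
Proof.
rewrite /=; suff : forall j, (forall i, 0 <= iter j (augment u n.+1) (weights u n) i) /\
    (weights u n i <= iter j (augment u n.+1) (weights u n) i) by move=> /(_ (rounds n.+1))[].
elim=> [|j [g0 IH]]; first by split=> // k; apply: weights_ge0.
rewrite /=; set h := iter j _ _ in g0 IH *.
have h_le := augment_ge n.+1 g0.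
by split=> [k|]; [apply: le_trans (g0 k) _ | apply: le_trans IH _].
Qed.

Lemma weights_coverage n e (b : pred nat) : e \in E ->
  (forall i, b i -> alive u (weights u n) e i) ->
  c%:R * ((count b (index_iota 0 n))%:R - (cap e)%:R) <=
    \sum_(0 <= i < n | b i) weights u n i.
Proof.
move=> eE; apply: unviolated_coverage; first exact: weights_ge0.
have [_ /existsPn nv] := weights_invariant n.
by apply/negP => ve; have /negP := nv e; rewrite eE.
Qed.

(** The potential bound [2 ^ k <= (2 * c) ^ w] limits [k] after taking logarithms, and each step
    costs at most [5 * c]. *)
Lemma sum_weights_le n B : respects n B ->
  \sum_(0 <= i < n) weights u n i <=
    (5 * c)%:R * (ln (2 * c)%:R / ln 2)
      * (count (fun i => ~~ B i) (index_iota 0 n))%:R.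
Proof.
move=> rB; have [[k [rg _ _ hg pg]] _] := weights_invariant n.
set w := count _ _; apply: le_trans hg _.
have c2 : 1 <= (2 * c)%:R :> R by rewrite ler1n muln_gt0.
have {pg} : 2 ^+ k <= (2 * c)%:R ^+ w :> R.
  apply: le_trans (pg B rB) _.
  rewrite -iter_mulr_1 -big_const_seq; apply: ler_prod => i _.
  rewrite le_max ler01 orbT ge_max c2 andbT /=.
  by case: (rg i) => [->|/andP[]] //; apply: le_trans c2.
have ln2 : 0 < ln 2 :> R by rewrite ln_gt0 // ltr1n.
have c0 : 0 < (2 * c)%:R :> R by rewrite (lt_le_trans ltr01).
move=> kw; have : ln (2 ^+ k) <= ln ((2 * c)%:R ^+ w) :> R.
  by rewrite ler_ln ?posrE ?exprn_gt0.
rewrite !lnXn // => {}kw.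
rewrite natrM -mulrA ler_wpM2l // mulrAC ler_pdivlMr //.
by move: kw; rewrite -[ln 2 *+ k]mulr_natl -[_ *+ w]mulr_natr.
Qed.

End FractionalAlgorithm.

(** * Threshold rounding *)

Section Rounding.

Variables (R : realType) (T : finType) (E : {set T}) (cap : T -> nat) (c : nat).
Variable (a : R).

Definition dropped (d : nat -> nat) u n i : bool :=
  (d i)%:R < a * weights R E cap c u n i.

(* d i is the digit drawn by request i; kept d u n is the set of requests that
   are accepted once n requests have arrived. *)
Fixpoint kept (d : nat -> nat) u n : pred nat :=
  if n is k.+1 then fun i => ~~ dropped d u n i &&
    (if (i < k)%N then kept d u k i else (i == k) && [forall e in E, u k e ==>
       (count (fun j => [&& kept d u k j, ~~ dropped d u n j & u j e])
          (index_iota 0 k) < cap e)%N])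
  else pred0.

(* The necessary condition, in terms of thresholds only, for edge e to cause the
   rejection of request i on arrival. *)
Definition overflow (d : nat -> nat) u i e : bool :=
  (cap e < count (fun j => u j e && ~~ dropped d u i.+1 j) (index_iota 0 i.+1))%N.

Lemma keptS d u n i : (i < n)%N -> kept d u n.+1 i -> kept d u n i.
Proof. by move=> i_n /=; rewrite i_n => /andP[]. Qed.

Lemma kept_ext d d' u v n : (forall i, (i < n)%N -> d i = d' i) ->
  (forall i, (i < n)%N -> u i = v i) -> kept d u n = kept d' v n.
Proof.
elim: n => // n IH dd uv; apply/funext => i /=.
have dr j : (j < n.+1)%N -> dropped d u n.+1 j = dropped d' v n.+1 j.
  by move=> jn; rewrite /dropped dd // (weights_ext _ _ _ _ uv).
have {}IH := IH (fun i i_n => dd i (leqW i_n)) (fun i i_n => uv i (leqW i_n)).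
case: ltngtP => [i_n|n_i|->]; rewrite ?andbF // ?dr ?(ltnW i_n) ?IH //=.
  exact: leqW.
congr (_ && _); apply: eq_forallb => e; rewrite uv //; congr (_ ==> (_ ==> (_ < _)%N)).
apply: eq_in_count => j; rewrite mem_index_iota /= => jn.
by rewrite dr ?uv // leqW.
Qed.

Lemma kept_respects d u n : respects E cap u n (kept d u n).
Proof.
elim: n => [|n IH] e eE //.
rewrite count_index_iotaS; set x := count _ _.
have xE : x = count (fun j => [&& kept d u n j, ~~ dropped d u n.+1 j & u j e])
    (index_iota 0 n).
  apply: eq_in_count => j; rewrite mem_index_iota => /= jn.
  by rewrite jn andbCA andbA.
have xn : (x <= count (fun i => kept d u n i && u i e) (index_iota 0 n))%N.
  by rewrite xE; apply: sub_count => j /= /and3P[-> _ ->].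
case: (boolP (u n e)) => une; last by rewrite andbF addn0 (leq_trans xn) // IH.
rewrite /= ltnn eqxx andbT /=; case: forallP => [/(_ e)|_].
  by rewrite eE une /= -xE; case: dropped; rewrite /= ?addn0 ?addn1 // => /ltnW.
by rewrite andbF addn0 (leq_trans xn) // IH.
Qed.

Hypothesis c_gt0 : (0 < c)%N.
Hypothesis cap_le : forall e, e \in E -> (cap e <= c)%N.
Hypothesis a_ge1 : 1 <= a.

Let a_ge0 : 0 <= a. Proof. exact: le_trans a_ge1. Qed.

(** A request below its threshold at some time remains so, since weights only grow. One refused on
    arrival met an edge with [cap e] undropped requests, and it is itself one more. *)
Lemma not_kept d u n i : (i < n)%N -> ~~ kept d u n i ->
  dropped d u n i || [exists e in E, u i e && overflow d u i e].
Proof.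
elim: n => // n IH; rewrite ltnS leq_eqVlt => /predU1P[->|i_n] /=.
  rewrite ltnn eqxx /=; case: (boolP (dropped _ _ _ _)) => //= nd.
  move=> /forallPn[e]; rewrite !negb_imply -leqNgt => /and3P[eE une le].
  apply/existsP; exists e; rewrite eE une /overflow andTb.
  rewrite count_index_iotaS /= nd une addn1 ltnS.
  apply: leq_trans le _; apply: sub_count => j /=.
  by case/and3P=> _ -> ->.
rewrite i_n negb_and negbK; case: (boolP (dropped _ _ n.+1 _)) => //= nd /IH.
move=> /(_ i_n)/orP[dr|//].
move: nd; rewrite /dropped (lt_le_trans dr) // ler_wpM2l //.
exact: weights_leS.
Qed.

End Rounding.

(** Each arrival through [e] after the first [cap e] counts once; an offline solution must reject at
    least that many. *)
Lemma sum_overfull (T : Type) (cap : T -> nat) (u : nat -> T -> bool) e n :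
  (\sum_(0 <= i < n) (u i e && (cap e < count (u^~ e) (index_iota 0 i.+1))) =
   count (u^~ e) (index_iota 0 n) - cap e)%N.
Proof.
elim: n => [|n IH]; first by rewrite big_geq.
rewrite big_nat_recr // IH !count_index_iotaS /=; case: (u n e); lia.
Qed.

(* Digit i, from the most significant one, of k < c ^ n written with n digits. *)
Definition base_digits (c n k i : nat) : nat := (k %/ c ^ (n - i.+1) %% c)%N.

(** Independence of the digits: as [k] runs below [c ^ n], its digits form every string exactly
    once. The induction splits off the last digit. *)
Lemma sum_prod_base_digits (R : comNzRingType) (c n : nat) (h : nat -> nat -> R) :
  (0 < c)%N ->
  \sum_(0 <= k < c ^ n) \prod_(0 <= i < n) h i (base_digits c n k i) =
  \prod_(0 <= i < n) \sum_(0 <= x < c) h i x.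
Proof.
move=> c0; elim: n => [|n IH]; first by rewrite expn0 big_nat1 !big_geq.
rewrite expnSr big_nat_mul big_nat_recr //= -IH mulr_suml.
apply: eq_bigr => k _; rewrite mulr_sumr.
rewrite mulSn -[X in \sum_(X <= _ < _) _](add0n (k * c)%N) big_addn addnK.
apply: eq_big_nat => x /andP[_ xc]; rewrite big_nat_recr //=; congr (_ * h n _).
  apply: eq_big_nat => i /andP[_ i_n]; congr (h i _); rewrite /base_digits.
  by rewrite subSn // expnS divnMA divnDMl // (divn_small xc).
by rewrite /base_digits subnn expn0 divn1 addnC modnMDl modn_small.
Qed.

(** * Probability that a uniform digit falls below a threshold *)

Section ThresholdProbability.

Variables (R : realType) (c : nat).
Hypothesis c_gt0 : (0 < c)%N.

Lemma sum_lt_ge (y : R) : 0 <= y -> y <= c%:R ->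
  y <= \sum_(0 <= x < c) (x%:R < y)%R%:R.
Proof.
move=> y0; elim: c => [|k IH] yk; first by rewrite big_geq // (le_trans yk).
rewrite big_nat_recr //=; have [yk'|ky] := leP y k%:R; first by rewrite addr0 IH.
have {IH} -> : \sum_(0 <= x < k) (x%:R < y)%R%:R = k%:R :> R.
  rewrite (eq_big_nat _ _ (F2 := fun=> 1)); first by rewrite sumr_const_nat subn0.
  move=> x /andP[_ xk]; have -> // : x%:R < y by apply: lt_trans ky; rewrite ltr_nat.
by rewrite natr1.
Qed.

(** Rounding up costs at most 1, which is at most [y] once [1 <= y]; hence the gap between 0 and 1
    in the range of the weights. *)
Lemma sum_lt_le (y : R) : y = 0 \/ 1 <= y ->
  \sum_(0 <= x < c) (x%:R < y)%R%:R <= 2 * y.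
Proof.
case=> [->|y1].
  by rewrite mulr0 big1 // => x _; rewrite ltNge ler0n.
suff : \sum_(0 <= x < c) (x%:R < y)%R%:R <= y + 1 by move=> /le_trans; apply; lra.
suff : \sum_(0 <= x < c) (x%:R < y)%R%:R <= y + 1 /\
  \sum_(0 <= x < c) (x%:R < y)%R%:R <= c%:R :> R by case.
elim: c => [|k [IH1 IH2]]; first by rewrite big_geq //; split=> //; lra.
rewrite big_nat_recr //= -natr1; have [yk|ky] := leP y k%:R; rewrite /= ?addr0 ?lerD2r.
  by split=> //; rewrite (le_trans IH2) // lerDl.
by split=> //; rewrite (le_trans IH2) // ltW.
Qed.

(** Up to the factor [c], the left side is the mean of [2 ^ (- X)] for the indicator [X] of a digit
    below [y]. As [X = 1] has probability at least [y / c], this mean is at most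
    [1 - y / (2 * c)]. *)
Lemma mgf_threshold (y : R) : 0 <= y -> y <= c%:R ->
  \sum_(0 <= x < c) (if x%:R < y then 2^-1 else 1) <=
    c%:R * expR (- (y / (2 * c%:R))).
Proof.
move=> y0 yc; have cR : 0 < c%:R :> R by rewrite ltr0n.
have -> : \sum_(0 <= x < c) (if x%:R < y then 2^-1 else 1) =
    c%:R - 2^-1 * \sum_(0 <= x < c) (x%:R < y)%R%:R :> R.
  have -> : c%:R = \sum_(0 <= x < c) 1 :> R by rewrite sumr_const_nat subn0.
  rewrite mulr_sumr -sumrB.
  by apply: eq_bigr => x _; case: (_ < _); rewrite /= ?mulr1 ?mulr0 ?subr0 //; lra.
apply: (@le_trans _ _ (c%:R * (1 - y / (2 * c%:R)))).
  have -> : c%:R * (1 - y / (2 * c%:R)) = c%:R - 2^-1 * y.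
    by field; rewrite gt_eqF.
  by rewrite lerD2l lerN2 ler_wpM2l // sum_lt_ge.
by rewrite ler_wpM2l ?expR_ge1Dx // ltW.
Qed.

End ThresholdProbability.

(** * Expected number of rejections over uniform digit strings *)

Section ExpectedRejections.

Variables (R : realType) (T : finType) (E : {set T}) (cap : T -> nat) (c : nat).
Variables (a : R) (u : nat -> T -> bool).
Hypothesis c_gt0 : (0 < c)%N.
Hypothesis cap_le : forall e, e \in E -> (cap e <= c)%N.
Hypothesis a_ge2 : 2 <= a.

Let cR : 0 < c%:R :> R. Proof. by rewrite ltr0n. Qed.
Let a_ge1 : 1 <= a. Proof. by move: a_ge2; lra. Qed.

Lemma base_digits_lt n k i : (base_digits c n k i < c)%N.
Proof. by rewrite ltn_mod. Qed.

Lemma sum_base_digit n i (f : nat -> R) : (i < n)%N ->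
  \sum_(0 <= k < c ^ n) f (base_digits c n k i) =
  c%:R ^+ n * ((\sum_(0 <= x < c) f x) / c%:R).
Proof.
move=> i_n; pose h j x := if j == i then f x else 1.
transitivity (\sum_(0 <= k < c ^ n) \prod_(0 <= j < n) h j (base_digits c n k j)).
  by apply: eq_bigr => k _; rewrite -big_mkcond big_nat1_eq /= i_n.
rewrite sum_prod_base_digits //.
transitivity (\prod_(0 <= j < n)
   (c%:R * (if j == i then (\sum_(0 <= x < c) f x) / c%:R else 1))).
  apply: eq_bigr => j _; rewrite /h; case: eqP => _.
    by rewrite mulrC divfK // gt_eqF.
  by rewrite sumr_const_nat subn0 mulr1.
by rewrite big_split /= prodr_const_nat subn0 -big_mkcond big_nat1_eq /= i_n.
Qed.

Lemma sum_dropped n i : (i < n)%N ->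
  \sum_(0 <= k < c ^ n) (dropped E cap c a (base_digits c n k) u n i)%:R <=
  c%:R ^+ n * (2 * a / c%:R * weights R E cap c u n i).
Proof.
move=> i_n; rewrite /dropped; set y := a * _.
rewrite (sum_base_digit (fun x => (x%:R < y)%R%:R)) //.
rewrite ler_wpM2l ?exprn_ge0 // ?ler0n // mulrAC ler_wpM2r ?invr_ge0 // ?ler0n //.
rewrite -mulrA; apply: sum_lt_le; rewrite /y.
have [->|/andP[w1 _]] := weights_range R u c_gt0 cap_le n i; first by left; rewrite mulr0.
by right; move: a_ge1; nra.
Qed.

(** Chernoff bound for the number of dropped requests on [e], by the moment method with base 2. *)
Lemma sum_overflow n i e : (i < n)%N -> e \in E ->
  \sum_(0 <= k < c ^ n) (overflow E cap c a (base_digits c n k) u i e)%:R <=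
  c%:R ^+ n * (expR (1 - a / 2) *
    (cap e < count (u^~ e) (index_iota 0 i.+1))%N%:R).
Proof.
move=> i_n eE; set N := i.+1; set w := weights R E cap c u N.
have w_ge0 j : 0 <= w j by apply: weights_ge0.
have a_gt0 : 0 < a by apply: lt_le_trans a_ge1.
(* Requests with [c <= a * w j] are dropped whatever their digit, so only those in [b] can make [e]
   overflow. *)
pose b j := u j e && (a * w j < c%:R); set s := index_iota 0 N.
have b_overflow d : (forall j, d j < c)%N -> overflow E cap c a d u i e ->
    (cap e < count (fun j => b j && ~~ ((d j)%:R < a * w j)%R) s)%N.
  move=> dc /leq_trans -> //; apply: sub_count => j /andP[uj nd].
  rewrite /b uj nd /= andbT (le_lt_trans _ (_ : (d j)%:R < _)) ?ltr_nat //.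
  by rewrite leNgt.
have [Dle|Dgt] := leqP (count b s) (cap e).
  rewrite big1 => [|k _]; first by rewrite !mulr_ge0 ?exprn_ge0 ?expR_ge0 ?ler0n.
  apply/eqP; rewrite pnatr_eq0 eqb0; apply/negP => /b_overflow.
  move=> /(_ (base_digits_lt n k)); rewrite ltnNge (leq_trans _ Dle) //.
  by apply: sub_count => j /andP[].
have -> : (cap e < count (u^~ e) s)%N.
  by rewrite (leq_trans Dgt) //; apply: sub_count => j /andP[].
rewrite mulr1; set D := (count b s - cap e)%N.
(* If e overflows, at most D requests of b are dropped, so the indicator is at
   most 2 ^ D times the product of the factors h, which are independent. *)
pose h j x : R := if [&& b j, (j < N)%N & x%:R < a * w j] then 2^-1 else 1.
apply: (@le_trans _ _ (\sum_(0 <= k < c ^ n)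
    2 ^+ D * \prod_(0 <= j < n) h j (base_digits c n k j))).
  apply: ler_sum => k _; set d := base_digits c n k.
  have h_gt0 : 0 < \prod_(0 <= j < n) h j (d j).
    by apply: prodr_gt0 => j _; rewrite /h; case: ifP.
  have [/b_overflow|_] := boolP (overflow _ _ _ _ _ _ _ _); last first.
    by rewrite mulr_ge0 ?exprn_ge0 ?ltW.
  move=> /(_ (base_digits_lt n k)) ov.
  have -> : \prod_(0 <= j < n) h j (d j) =
      2^-1 ^+ count (fun j => b j && ((d j)%:R < a * w j)) s.
    rewrite -big_mkcond -iter_mulr_1 -big_const_seq /s.
    rewrite (big_nat_widen _ _ _ _ _ i_n); apply: eq_bigl => j.
    by rewrite -andbA [_ && (j < N)%N]andbC.
  move: ov; set Z := count _ _; set Y := count _ _ => ov.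
  have YZ : count b s = (Y + Z)%N by rewrite (count_split _ (fun j => (d j)%:R < a * w j)).
  have YD : (Y <= D)%N by rewrite /D; lia.
  by rewrite exprVn -exprB ?unitfE ?pnatr_eq0 // exprn_ege1 // ler1n.
rewrite -mulr_sumr sum_prod_base_digits //.
pose z j := if b j && (j < N)%N then a * w j / (2 * c%:R) else 0.
apply: (@le_trans _ _ (2 ^+ D * \prod_(0 <= j < n) (c%:R * expR (- z j)))).
  rewrite ler_wpM2l ?exprn_ge0 //; apply: ler_prod => j _; apply/andP; split.
    by apply: sumr_ge0 => x _; rewrite /h; case: ifP.
  rewrite /h /z; case: (boolP (b j)) => [/andP[_ /ltW wc]|_] /=; last first.
    by rewrite sumr_const_nat subn0 oppr0 expR0 mulr1.
  case: (ltnP j N) => jN /=; last by rewrite sumr_const_nat subn0 oppr0 expR0 mulr1.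
  by apply: mgf_threshold => //; rewrite mulr_ge0 // ltW.
rewrite big_split /= prodr_const_nat subn0 -expR_sum mulrCA.
rewrite ler_wpM2l ?exprn_ge0 ?ler0n // sumrN.
(* Members of [b] are alive because [1 <= a], so coverage bounds their total weight below by
   [c * D]. *)
have zD : a / 2 * D%:R <= \sum_(0 <= j < n) z j.
  rewrite /z -big_mkcond -big_nat_widen // -mulr_suml -mulr_sumr.
  have := weights_coverage c_gt0 cap_le eE (u := u) (n := N) (b := b) (R := R).
  rewrite -/w -/s => cov.
  have {}cov : c%:R * D%:R <= \sum_(0 <= i0 < N | b i0) w i0.
    rewrite /D (natrB _ (ltnW Dgt)).
    apply: cov => j /andP[uj wj].
    rewrite /alive /= uj (le_lt_trans _ wj) //.
    by rewrite -/w ler_peMl.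
  rewrite ler_pdivlMr ?mulr_gt0 //.
  by have := ler_wpM2l (ltW a_gt0) cov; lra.
have D1 : 1 <= D%:R :> R by rewrite ler1n subn_gt0.
(* By [2 <= expR 1]. Then [1 <= D] and [2 <= a] bound the exponent [D * (1 - a / 2)] by
   [1 - a / 2]. *)
apply: (@le_trans _ _ (expR D%:R * expR (- (a / 2 * D%:R)))).
  apply: ler_pM; rewrite ?exprn_ge0 ?expR_ge0 // ?ler_expR ?lerN2 //.
  rewrite -[D%:R]mulr1 expRM_natl lerXn2r ?nnegrE ?expR_ge0 //.
  by have := expR_ge1Dx (1 : R).
by rewrite -expRD ler_expR; move: a_ge2; nra.
Qed.

(** Union bound from [not_kept]: thresholds are charged to the weights, overflows to each edge
    separately. *)
Lemma sum_rejected n B : respects E cap u n B ->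
  \sum_(0 <= k < c ^ n)
    (count (fun i => ~~ kept E cap c a (base_digits c n k) u n i)
       (index_iota 0 n))%:R <=
  c%:R ^+ n * ((10 * a * (ln (2 * c)%:R / ln 2) + #|E|%:R * expR (1 - a / 2))
    * (count (fun i => ~~ B i) (index_iota 0 n))%:R).
Proof.
move=> rB; set w := count _ _; set s := index_iota 0 n; set S := index_iota 0 (c ^ n).
have split_le : \sum_(k <- S) (count (fun i => ~~ kept E cap c a (base_digits c n k) u n i) s)%:R
  <= \sum_(0 <= i < n) \sum_(k <- S) (dropped E cap c a (base_digits c n k) u n i)%:R
   + \sum_(0 <= i < n) \sum_(e in E | u i e) \sum_(k <- S)
       (overflow E cap c a (base_digits c n k) u i e)%:R :> R.
  rewrite -big_split /= (eq_bigr _ (fun k _ => natr_count _ _ _)) exchange_big /=.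
  rewrite /s big_nat_cond [leRHS]big_nat_cond; apply: ler_sum => i /andP[/andP[_ i_n] _].
  rewrite [X in _ <= _ + X]exchange_big -big_split /=; apply: ler_sum => k _.
  have [//|rej] := boolP (kept _ _ _ _ _ _ _ _).
    by move=> _; rewrite addr_ge0 ?sumr_ge0.
  have /orP[->|/existsP[e /and3P[eE uie ov]]] := not_kept c_gt0 cap_le a_ge1 i_n rej.
    by rewrite lerDl sumr_ge0.
  by rewrite (bigD1 e) ?eE //= ov addrCA lerDl addr_ge0 ?sumr_ge0.
apply: le_trans split_le _; rewrite mulrDl mulrDr.
apply: lerD.
  apply: (@le_trans _ _ (\sum_(0 <= i < n)
      c%:R ^+ n * (2 * a / c%:R * weights R E cap c u n i))).
    rewrite big_nat_cond [leRHS]big_nat_cond; apply: ler_sum => i.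
    by case/andP=> /andP[_ i_n] _; apply: sum_dropped.
  rewrite -!mulr_sumr ler_wpM2l ?exprn_ge0 ?ler0n //.
  have a2 : 0 <= 2 * a / c%:R by rewrite divr_ge0 ?ler0n //; move: a_ge1; lra.
  (* The factor [5 * c] times [2 * a / c] gives [10 * a]. *)
  apply: le_trans (ler_wpM2l a2 (sum_weights_le R c_gt0 cap_le rB)) _.
  rewrite -/w le_eqVlt; apply/orP; left; apply/eqP; rewrite natrM; field.
  by rewrite !gt_eqF // ln_gt0 // ltr1n.
rewrite -/w.
apply: (@le_trans _ _ (\sum_(0 <= i < n) \sum_(e in E | u i e)
   c%:R ^+ n * (expR (1 - a / 2) *
     (cap e < count (u^~ e) (index_iota 0 i.+1))%N%:R))).
  rewrite big_nat_cond [leRHS]big_nat_cond; apply: ler_sum => i.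
  case/andP=> /andP[_ i_n] _; apply: ler_sum => e /andP[eE _].
  exact: sum_overflow.
under eq_bigr do rewrite big_mkcondr.
rewrite exchange_big /=.
apply: (@le_trans _ _ (\sum_(e in E) c%:R ^+ n * (expR (1 - a / 2) * w%:R))); last first.
  rewrite sumr_const -[_ *+ #|E|]mulr_natl le_eqVlt; apply/orP; left; apply/eqP; ring.
apply: ler_sum => e eE.
have -> : \sum_(0 <= i < n) (if u i e then c%:R ^+ n * (expR (1 - a / 2) *
     (cap e < count (u^~ e) (index_iota 0 i.+1))%N%:R) else 0) =
   c%:R ^+ n * (expR (1 - a / 2) * (count (u^~ e) s - cap e)%:R) :> R.
  rewrite -sum_overfull natr_sum !mulr_sumr; apply: eq_bigr => i _.
  by case: (u i e); rewrite /= ?mulr0.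
rewrite !ler_wpM2l ?exprn_ge0 ?expR_ge0 ?ler0n // ler_nat.
(* Among the requests on [e], those in [B] fit into [cap e], and the others are rejections of
   [B]. *)
rewrite leq_subLR (count_split _ B) leq_add //.
  by apply: leq_trans (rB e eE); apply: sub_count => i /andP[-> ->].
by apply: sub_count => i /andP[].
Qed.

End ExpectedRejections.

(** * Digits of a uniform real number *)

Lemma truncn_mulr_divn (R : realType) (x : R) (q : nat) :
  (0 < q)%N -> (Num.truncn (x * q%:R) %/ q)%N = Num.truncn x.
Proof.
move=> q0; have qR : 0 < q%:R :> R by rewrite ltr0n.
have [x0|x0] := leP 0 x; last first.
  (* [Num.truncn] is 0 on negative reals. *)
  have neg (y : R) : y < 0 -> Num.truncn y = 0%N.
    by rewrite truncn_floor; case: leP.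
  by rewrite !neg ?div0n // pmulr_llt0.
have := truncn_itv (mulr_ge0 x0 (ltW qR)); set t := Num.truncn (x * _).
case/andP=> tx xt; apply/esym/truncn_def; apply/andP; split.
  rewrite -(ler_pM2r qR) (le_trans _ tx) // -natrM ler_nat; exact: leq_divM.
rewrite -(ltr_pM2r qR) (lt_le_trans xt) // -natrM ler_nat.
exact: ltn_ceil.
Qed.

(** The exponent [i.+1] starts at the first place after the radix point. No sequence length enters,
    so one [w] serves all prefixes consistently. *)
Definition digit (R : realType) (c : nat) (w : R) (i : nat) : nat :=
  (Num.truncn (w * c%:R ^+ i.+1) %% c)%N.

Lemma digit_base_digits (R : realType) (c n : nat) (w : R) i : (0 < c)%N ->
  (i < n)%N -> digit c w i = base_digits c n (Num.truncn (w * c%:R ^+ n)) i.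
Proof.
move=> c0 i_n; rewrite /digit /base_digits; congr (_ %% c)%N.
rewrite -(@truncn_mulr_divn _ _ (c ^ (n - i.+1))) ?expn_gt0 ?c0 //.
by rewrite natrX -mulrA -exprD subnKC.
Qed.

Section UniformTruncation.

Variables (R : realType) (q : nat).
Hypothesis q_gt0 : (0 < q)%N.

Local Notation P := (uniform_prob (@ltr01 R)).
Let qR : 0 < q%:R :> R. Proof. by rewrite ltr0n. Qed.

Lemma measurable_truncn (Q : pred nat) :
  measurable [set w : R | Q (Num.truncn (w * q%:R))]%classic.
Proof.
pose G j := [set w : R | (j <= Num.truncn (w * q%:R))%N]%classic.
have mG j : measurable (G j).
  case: j => [|j]; first by rewrite (_ : G 0%N = setT) //; apply/seteqP.
  rewrite (_ : G j.+1 = `[j.+1%:R / q%:R, +oo[%classic) //.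
  by apply/seteqP; split=> w; rewrite /G /= in_itv /= andbT truncn_gt_nat ler_pdivrMr.
rewrite (_ : mkset _ = \bigcup_(k in [set k | Q k]) (G k `\` G k.+1))%classic.
  by apply: bigcup_measurable => k _; apply: measurableD.
apply/seteqP; split=> w /=.
  move=> Qw; exists (Num.truncn (w * q%:R)) => //; split; first exact: leqnn.
  by rewrite /G /=; apply/negP; rewrite -leqNgt.
case=> k Qk [/= kw /negP]; rewrite -leqNgt => wk.
by rewrite (_ : Num.truncn _ = k) //; apply/eqP; rewrite eqn_leq wk.
Qed.

Lemma uniform_prob01E (A : set R) : measurable A ->
  P A = lebesgue_measure (A `&` `[0, 1]%classic)%classic.
Proof.
move=> mA; rewrite /uniform_prob integral_uniform_pdf.
rewrite (eq_integral (fun=> 1%:E)).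
  by rewrite integral_cst ?mul1e //; apply: measurableI.
move=> x; rewrite inE => -[_ /=]; rewrite in_itv /= => x01; rewrite /uniform_pdf x01.
by rewrite subr0 invr1.
Qed.

(** On [[0, 1)] the event is a union of cells of length [1 / q]; the endpoint 1, whose truncation is
    [q], goes into a null singleton. *)
Lemma uniform_prob_truncn (Q : pred nat) :
  (P [set w : R | Q (Num.truncn (w * q%:R))]%classic <=
   ((\sum_(0 <= k < q) (Q k)%:R) / q%:R)%:E)%E.
Proof.
rewrite uniform_prob01E; last exact: measurable_truncn.
pose I k : set R := if Q k then `[k%:R / q%:R, k.+1%:R / q%:R[%classic else set0.
have mI k : measurable (I k) by rewrite /I; case: ifP.
apply: (@le_trans _ _ (lebesgue_measure (\big[setU/set0]_(k < q) I k `|` [set 1 : R])%classic)).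
  apply: le_measure; rewrite ?inE.
  - by apply: measurableI => //; exact: measurable_truncn.
  - apply: measurableU; last exact: measurable_set1.
    by apply: bigsetU_measurable => k _; exact: mI.
  - move=> w [/= Qw]; rewrite in_itv /= => /andP[w0]; rewrite le_eqVlt.
    case/predU1P=> [->|w1]; [by right | left].
    have wq0 : 0 <= w * q%:R by rewrite mulr_ge0.
    have tq : (Num.truncn (w * q%:R) < q)%N.
      by rewrite truncn_lt_nat // gtr_pMl.
    rewrite -bigcup_mkord; exists (Num.truncn (w * q%:R)) => //.
    rewrite /I Qw /= in_itv /= ler_pdivrMr // ltr_pdivlMr //.
    exact: truncn_itv.
rewrite measureU0 //; first last.
- exact: lebesgue_measure_set1.
- by apply: bigsetU_measurable => k _; exact: mI.
apply: le_trans.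
  by apply: Boole_inequality => k _; exact: mI.
rewrite big_mkord mulr_suml -sumEFin; apply: lee_sum => k _.
rewrite /I; case: (Q k); last by rewrite measure0 mul0r.
apply: (@le_trans _ _ (lebesgue_measure (`[k%:R / q%:R, k.+1%:R / q%:R[%classic : set R))) => //.
rewrite lebesgue_measure_itv /= lte_fin ltr_pM2r ?invr_gt0 // ltr_nat ltnSn.
by rewrite -EFinD -mulrBl -natr1 addrC addKr.
Qed.

End UniformTruncation.

(** * The randomized algorithm *)

Section RandomizedRounding.

Variables (R : realType) (G : network).

(** The default [false] lets positions beyond the end of [s] use no edge. *)
Definition usage (s : seq (request G)) (i : nat) (e : vertex G * vertex G) :=
  nth false [seq uses r e | r <- s] i.

Lemma usageE (s : seq (request G)) (i : 'I_(size s)) e :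
  usage s i e = uses (tnth (in_tuple s) i) e.
Proof. by have x0 := tnth (in_tuple s) i; rewrite /usage (nth_map x0) // (tnth_nth x0). Qed.

Lemma usage_rcons (s : seq (request G)) r i :
  (i < size s)%N -> usage (rcons s r) i = usage s i.
Proof.
by move=> i_s; apply/funext => e; rewrite /usage map_rcons nth_rcons size_map i_s.
Qed.

Lemma card_ord_count n (P : pred nat) :
  #|[set i : 'I_n | P i]| = count P (index_iota 0 n).
Proof. by rewrite cardsE -sum1_card -sum1_count big_mkord. Qed.

Lemma respects_card (s : seq (request G)) (B : pred nat) e :
  count (fun i => B i && usage s i e) (index_iota 0 (size s)) =
  #|[set i in [set i : 'I_(size s) | B i] | uses (tnth (in_tuple s) i) e]|.
Proof.
by rewrite -card_ord_count; apply: eq_card => i; rewrite !inE usageE.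
Qed.

(** The maximum with 1 keeps the base of the digits positive for a network without edges. *)
Definition granularity : nat := maxn 1 (max_capacity G).

(** Chosen so that [expR (1 - boost / 2)] equals [1 / (1 + m)] for [m] edges. *)
Definition boost : R := 2 + 2 * ln (1 + #|edges G|%:R).

Definition survivors (d : nat -> nat) (s : seq (request G)) : pred nat :=
  kept (edges G) (@capacity G) granularity boost d (usage s) (size s).

Lemma granularity_gt0 : (0 < granularity)%N.
Proof. by rewrite leq_max. Qed.

Lemma capacity_le_granularity e : e \in edges G -> (capacity e <= granularity)%N.
Proof.
move=> eG; rewrite leq_max; apply/orP; right.
by rewrite /max_capacity; apply: leq_bigmax_cond.
Qed.

Lemma boost_ge2 : 2 <= boost.
Proof. by rewrite lerDl mulr_ge0 // ln_ge0 // lerDl. Qed.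

Lemma survivors_feasible d s :
  feasible [set i : 'I_(size s) | survivors d s i].
Proof.
apply/forallP => e; apply/implyP => eG; rewrite -respects_card.
exact: kept_respects.
Qed.

Lemma survivors_rcons d s r (i : 'I_(size s)) (j : 'I_(size (rcons s r))) :
  i = j :> nat -> j \in [set k : 'I_(size (rcons s r)) | survivors d (rcons s r) k] ->
  i \in [set k : 'I_(size s) | survivors d s k].
Proof.
move=> ij; rewrite !inE -ij /survivors size_rcons => /(keptS (ltn_ord i)).
rewrite (@kept_ext _ _ _ _ _ _ _ d _ (usage s)) // => k k_s.
exact: usage_rcons.
Qed.

Definition rounding (d : nat -> nat) : online_algorithm G :=
  OnlineAlgorithm (survivors_feasible d) (@survivors_rcons d).

Lemma in_rounding d s (i : 'I_(size s)) :
  (i \in accepted (rounding d) s) = survivors d s i.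
Proof. by rewrite inE. Qed.

(** The integer [k] encodes the first [size s] digits; it comes last so that the event is a
    predicate on a truncation. *)
Definition prefix_survivors (s : seq (request G)) i : pred nat :=
  fun k => survivors (base_digits granularity (size s) k) s i.

Lemma survivors_digit (w : R) s i : survivors (digit granularity w) s i =
  prefix_survivors s i (Num.truncn (w * (granularity ^ size s)%:R)).
Proof.
rewrite /prefix_survivors /survivors; congr (_ i); apply: kept_ext => // k k_s.
by rewrite (digit_base_digits w granularity_gt0 k_s) natrX.
Qed.

Lemma measurable_rounding s (i : 'I_(size s)) :
  measurable [set w : R | i \in accepted (rounding (digit granularity w)) s]%classic.
Proof.
under eq_set do rewrite in_rounding survivors_digit.
by apply: measurable_truncn; rewrite expn_gt0 granularity_gt0.
Qed.

Definition random_rounding : randomized_algorithm R G :=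
  @RandomizedAlgorithm R G _ (measurableTypeR R) (uniform_prob (@ltr01 R))
    (fun w => rounding (digit granularity w)) measurable_rounding.

Lemma expected_cost_rounding s :
  (expected_cost random_rounding s <=
   ((\sum_(0 <= k < granularity ^ size s)
      (count (fun i => ~~ prefix_survivors s i k) (index_iota 0 (size s)))%:R) /
    granularity%:R ^+ size s)%:E)%E.
Proof.
set q := (granularity ^ size s)%N.
have q0 : (0 < q)%N by rewrite expn_gt0 granularity_gt0.
pose Rej (i : 'I_(size s)) := [set w : R | ~~ prefix_survivors s i (Num.truncn (w * q%:R))]%classic.
have mRej i : measurable (Rej i).
  exact: (measurable_truncn q0 (fun k => ~~ prefix_survivors s i k)).
have RejE w i : (w \in Rej i) = ~~ prefix_survivors s i (Num.truncn (w * q%:R)).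
  by apply/idP/idP; rewrite inE.
rewrite /expected_cost unlock /=.
under eq_integral => w _.
  rewrite (_ : (cost _)%:R%:E = (\sum_(i < size s) (\1_(Rej i) w)%:E)%E); last first.
    rewrite /cost -sum1_card big_mkcond natr_sum sumEFin; congr (_%:E).
    apply: eq_bigr => i _; rewrite inE in_rounding survivors_digit indicE RejE.
    by case: prefix_survivors.
  over.
rewrite ge0_integral_sum //; last first.
  by move=> i; apply/measurable_EFinP; apply: measurable_indic; apply: mRej.
apply: (@le_trans _ _ (\sum_(i < size s)
   ((\sum_(0 <= k < q) (~~ prefix_survivors s i k)%:R) / q%:R)%:E)%E).
  apply: lee_sum => i _; rewrite integral_indic //; last exact: mRej.
  rewrite classical_sets.setIT.
  exact: (uniform_prob_truncn R q0 (fun k => ~~ prefix_survivors s i k)).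
rewrite sumEFin lee_fin -mulr_suml natrX exchange_big /=.
by under [in leRHS]eq_bigr do rewrite natr_count big_mkord.
Qed.

End RandomizedRounding.

(** The overflow term is [m / (1 + m)], at most 1. Since [m] and [c] are at least 1, both logarithms
    on the right are at least [ln 2] and absorb the additive constants; 40 is [10 * 2 * 2]. *)
Lemma ratio_le (R : realType) (m c : nat) : (0 < m)%N -> (0 < c)%N ->
  10 * (2 + 2 * ln (1 + m%:R)) * (ln (2 * c)%:R / ln 2)
    + m%:R * expR (1 - (2 + 2 * ln (1 + m%:R)) / 2) <=
  (40 * ((ln 2)^-1 + 1) / ln 2 + (ln 2)^-1 ^+ 2)
    * ln (1 + m%:R) * ln (1 + c%:R) :> R.
Proof.
move=> m0 c0; have m1 : 1 <= m%:R :> R by rewrite ler1n.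
have c1 : 1 <= c%:R :> R by rewrite ler1n.
have b0 : 0 < ln 2 :> R by rewrite ln_gt0 // ltr1n.
have b1 : 0 < (ln 2)^-1 :> R by rewrite invr_gt0.
have ln_ge (x : R) : 1 <= x -> ln 2 <= ln (1 + x).
  by move=> x1; rewrite ler_ln ?posrE; lra.
have lm := ln_ge _ m1; have lc := ln_ge _ c1.
have -> : 1 - (2 + 2 * ln (1 + m%:R)) / 2 = - ln (1 + m%:R) :> R by lra.
rewrite expRN lnK ?posrE; last lra.
have me : m%:R * (1 + m%:R)^-1 <= 1 :> R by rewrite ler_pdivrMr; lra.
have l2c : ln (2 * c)%:R <= 2 * ln (1 + c%:R) :> R.
  rewrite natrM lnM ?posrE ?ltr0n //.
  have : ln c%:R <= ln (1 + c%:R) :> R by rewrite ler_ln ?posrE; lra.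
  lra.
set b := (ln 2)^-1 in b1 *; set l := ln (1 + m%:R) in lm *.
set k := ln (1 + c%:R) in lc l2c *.
have bl : 1 <= b * l by rewrite mulrC ler_pdivlMr // mul1r.
have bk : 1 <= b * k by rewrite mulrC ler_pdivlMr // mul1r.
have l0 : 0 <= l by apply: le_trans lm; apply: ltW.
have k0 : 0 <= k by apply: le_trans lc; apply: ltW.
have t1 : (2 + 2 * l) * (ln (2 * c)%:R * b) <= (2 * (b + 1) * l) * (2 * k * b).
  apply: ler_pM.
  - lra.
  - by rewrite mulr_ge0 ?(ltW b1) // ln_ge0 // ler1n muln_gt0.
  - by have := bl; lra.
  - by rewrite ler_pM2r.
have t2 : 1 <= (b * l) * (b * k) by rewrite -[1]mulr1; apply: ler_pM.
have -> : (40 * (b + 1) * b + b ^+ 2) * l * k =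
  10 * ((2 * (b + 1) * l) * (2 * k * b)) + (b * l) * (b * k) by ring.
by rewrite -mulrA lerD ?(le_trans me) // ler_wpM2l.
Qed.

Lemma opt_witness (G : network) (s : seq (request G)) :
  exists2 B : pred nat,
    respects (edges G) (@capacity G) (usage s) (size s) B &
    count (fun i => ~~ B i) (index_iota 0 (size s)) = opt s.
Proof.
have f0 : feasible (finset.set0 : solution s).
  apply/forallP => e; apply/implyP => _.
  by rewrite (_ : finset _ = finset.set0) ?cards0 //; apply/setP => i; rewrite !inE.
rewrite /opt; case: arg_minnP => // A fA _.
pose B i := if insub i is Some j then j \in A else false.
have BE (i : 'I_(size s)) : B i = (i \in A) by rewrite /B valK.
exists B.
  move=> e eG; rewrite respects_card; have /forallP/(_ e) := fA; rewrite eG /=.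
  by apply: leq_trans; apply/subset_leq_card/fintype.subsetP => i; rewrite !inE BE.
by rewrite -card_ord_count /cost; apply: eq_card => i; rewrite !inE BE.
Qed.

Lemma opt_no_edges (G : network) (s : seq (request G)) :
  #|edges G| = 0%N -> opt s = 0%N.
Proof.
move=> /cards0_eq E0; rewrite /opt; case: arg_minnP => [|A _ Amin].
  by apply/forallP => e; rewrite E0 inE.
apply/eqP; rewrite -leqn0 (leq_trans (Amin finset.setT _)) //.
  by apply/forallP => e; rewrite E0 inE.
by rewrite /cost finset.setCT cards0.
Qed.

Theorem theorem3 (R : realType) :
  exists (A : forall G : network, randomized_algorithm R G) (K : R),
    0 < K /\
    forall G : network,
      competitive (A G)
        (K * ln (1 + #|edges G|%:R) * ln (1 + (max_capacity G)%:R)).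
Proof.
have b0 : 0 < ln 2 :> R by rewrite ln_gt0 // ltr1n.
exists (@random_rounding R), (40 * ((ln 2)^-1 + 1) / ln 2 + (ln 2)^-1 ^+ 2).
split; first by rewrite addr_gt0 ?exprn_gt0 ?divr_gt0 ?mulr_gt0 ?addr_gt0 ?invr_gt0.
move=> G s; apply: le_trans (expected_cost_rounding R s) _; rewrite lee_fin.
have [B rB wE] := opt_witness s.
have := sum_rejected (granularity_gt0 G) (@capacity_le_granularity G) (boost_ge2 R G) rB.
rewrite wE ler_pdivrMr ?exprn_gt0 ?ltr0n ?granularity_gt0 // => /le_trans; apply.
rewrite mulrC ler_wpM2r ?exprn_ge0 ?ler0n //.
(* Without edges the competitive factor is 0, and so is the optimum. *)
have [E0|m0] := posnP #|edges G|; first by rewrite (opt_no_edges s E0) !mulr0.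
have /set0Pn[e eE] : edges G != finset.set0 by rewrite -card_gt0.
have c0 : (0 < max_capacity G)%N.
  apply: leq_trans (capacity_gt0 eE) _.
  by rewrite /max_capacity; apply: leq_bigmax_cond.
rewrite ler_wpM2r ?ler0n //; have := ratio_le R m0 c0.
by rewrite /boost /granularity (maxn_idPr c0).
Qed.
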